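(* Let $n$ be a positive integer, let $S\subseteq\{1,\dots,n-1\}$ be closed under taking additive inverses modulo $n$, let $G=\operatorname{Circ}(n,S)$, and let $k$ be a nonnegative integer. The following are equivalent. (1) There exists a positive semidefinite Hermitian circulant matrix with rank $k$ and graph $G$. (2) There exists a cyclically symmetric orthogonal representation for $G$ over $\mathbb C$ with rank $k$. (3) There exists a vector $x\in\mathbb R^n$ with nonnegative coordinates and support of size $k$ such that $i\mapsto U_n^i x$ is an orthogonal representation for $G$.
   Context: Vectors and matrices are indexed from $0$. $\operatorname{Circ}(n,S)$ is the simple graph on vertex set $\{0,1,\dots,n-1\}$ in which $i,j$ are adjacent iff $(i-j)\bmod n\in S$. An $n\times n$ Hermitian matrix $A$ has graph $G$ (where $V(G)=\{0,\dots,n-1\}$) if for all $i\ne j$: $A_{ij}\neq 0$ iff $\{i,j\}\in E(G)$; diagonal entries are unrestricted. $A$ is a circulant matrix if $A_{ij}$ depends only on $i-j$ modulo $n$. An orthogonal representation for $G$ in $\mathbb C^d$ is a function $r:V(G)\to\mathbb C^d$ such that for distinct vertices $v,w$: $\langle r(v),r(w)\rangle\neq 0$ iff $\{v,w\}\in E(G)$. It is said to be over $\mathbb C$ (with $d$ arbitrary); its rank is the dimension of the span of its image. It is cyclically symmetric (with $V(G)=\{0,\dots,n-1\}$) if there are a $d\times d$ unitary matrix $U$ with $U^n=I$ and $x\in\mathbb C^d$ such that $r(i)=U^i x$ for all $i\in\{0,\dots,n-1\}$. $\omega=e^{2\pi i/n}$ and $U_n=\operatorname{diag}(1,\omega,\omega^2,\dots,\omega^{n-1})$.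 The support of a vector is the set of indices of its nonzero coordinates. *)

(* Defs.v *)
From mathcomp Require Import all_boot all_order all_algebra.
From mathcomp Require Import complex reals trigo.

Set Implicit Arguments.
Unset Strict Implicit.
Unset Printing Implicit Defensive.

Import Order.TTheory GRing.Theory Num.Theory.
Local Open Scope ring_scope.
Local Open Scope sesquilinear_scope.

(* The vertex set is 'I_n. As i, j < n, the natural number (i + (n - j)) %% n
   is (i - j) mod n. *)
Definition circ_graph (n : nat) (S : {pred nat}) : rel 'I_n :=
  fun i j => ((i + (n - j)) %% n)%N \in S.

Lemma circ_graph_irrefl (n : nat) (S : {pred nat}) :
  {in S, forall s, (0 < s < n)%N} -> irreflexive (@circ_graph n S).
Proof.
move=> S_n i; apply/negP => /S_n.
by rewrite subnKC ?modnn // ltnW.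
Qed.

Lemma circ_graph_sym (n : nat) (S : {pred nat}) :
  {in S, forall s, ((n - s) %% n)%N \in S} -> symmetric (@circ_graph n S).
Proof.
move=> S_opp.
suff sub (i j : 'I_n) : circ_graph S i j -> circ_graph S j i.
  by move=> i j; apply/idP/idP; apply: sub.
move=> e_ij; have := S_opp _ e_ij; rewrite /circ_graph.
set r := ((i + (n - j)) %% n)%N.
suff -> : ((n - r) %% n = (j + (n - i)) %% n)%N by [].
have r_lt : (r < n)%N by rewrite ltn_mod (leq_ltn_trans _ (ltn_ord i)).
apply/eqP; rewrite -(eqn_modDr r) subnK; last exact: ltnW.
rewrite modnDmr (addnC i) addnACA subnKC ?subnK ?(ltnW (ltn_ord _)) //.
by rewrite modnDr.
Qed.

Section Representations.
Variable C : numClosedFieldType.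

Definition has_graph (n : nat) (e : rel 'I_n) (A : 'M[C]_n) : Prop :=
  forall i j, i != j -> (A i j != 0) = e i j.

Definition circulantmx (n : nat) (A : 'M[C]_n) : Prop :=
  forall i j i' j' : 'I_n, (i + j' = i' + j %[mod n])%N -> A i j = A i' j'.

(* 0 <= z on a numClosedFieldType means that z is real and nonnegative. *)
Definition psdmx (n : nat) (A : 'M[C]_n) : Prop :=
  A \is hermsymmx /\ forall x : 'cV[C]_n, 0 <= (x ^t* *m A *m x) 0 0.

(* dotmx is the standard Hermitian product, stated for row vectors. *)
Definition cdot (d : nat) (v w : 'cV[C]_d) : C := dotmx v^T w^T.

Definition orth_rep (n : nat) (e : rel 'I_n) (d : nat) (r : 'I_n -> 'cV[C]_d) :
    Prop :=
  forall v w, v != w -> (cdot (r v) (r w) != 0) = e v w.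

Definition rep_rank (n d : nat) (r : 'I_n -> 'cV[C]_d) : nat :=
  \dim <<[seq r i | i : 'I_n]>>%VS.

Definition cyclically_symmetric (n d : nat) (r : 'I_n -> 'cV[C]_d) : Prop :=
  exists (U : 'M[C]_d) (x : 'cV[C]_d),
    [/\ U \is unitarymx, U ^+ n = 1%:M & forall i : 'I_n, r i = U ^+ i *m x].

End Representations.

Section UnitaryDiagonal.
Variable R : realType.

(* The complex number exp (2 pi i / n). *)
Definition omega (n : nat) : R[i] :=
  Complex (cos (2 * pi / n%:R)) (sin (2 * pi / n%:R)).

Definition Umx (n : nat) : 'M[R[i]]_n := diag_mx (\row_(j < n) omega n ^+ j).

End UnitaryDiagonal.

(* Main.v *)
Require Import Defs.
From mathcomp Require Import all_boot all_order all_algebra.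
From mathcomp Require Import complex reals trigo.

(** The three kinds of object are linked by Gram matrices. The Gram matrix of
    a family r(0), ..., r(n-1) is positive semidefinite, has the rank of the
    family (M and M M* have the same rank), and has graph G exactly when r is
    an orthogonal representation for G. If r(i) = U^i x with U unitary and
    U^n = I, then <r(i), r(j)> depends only on i - j modulo n, so the Gram
    matrix is circulant. This gives (2) => (1), and (3) => (1) as the special
    case U = diag(1, w, ..., w^(n-1)), with w = exp(2 pi i / n).

    For the way back, let A be a positive semidefinite circulant matrix. The
    discrete Fourier matrix F = (w^(ij)) diagonalizes it: A = F diag(d) F*
    ([psd_circulant_dft]), where the n d_l are the eigenvalues of A, hence
    d_l >= 0. Put x_l = sqrt(d_l). The matrix with rows (U^i x)^T is
    F diag(x), so the Gram matrix of i |-> U^i x is F diag(x)^2 F* = A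
    ([psd_circulant_clockrep]). As F is invertible, the rank of this family is
    the size of the support of x ([rep_rank_clockrep]). Hence (1) => (2), and
    (2) => (3) by applying the same construction to the Gram matrix of the
    given representation. *)

Import VectorInternalTheory Order.TTheory GRing.Theory Num.Theory.
Local Open Scope ring_scope.
Local Open Scope sesquilinear_scope.

Set Implicit Arguments.
Unset Strict Implicit.

(** * Gram matrices of finite families *)

Lemma rank_diag_mx (F : fieldType) (n : nat) (d : 'rV[F]_n) :
  \rank (diag_mx d) = #|[set i | d 0 i != 0]|.
Proof.
have -> : \rank (diag_mx d) =
    \rank (\sum_(i | d 0 i != 0) <<delta_mx 0 i : 'rV[F]_n>>)%MS.
  apply: eqmx_rank; apply/andP; split.
    apply/row_subP => i; rewrite row_diag_mx.
    have [-> | di_neq0] := eqVneq (d 0 i) 0; first by rewrite scale0r sub0mx.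
    by apply: scalemx_sub; apply: (sumsmx_sup i); rewrite ?genmxE.
  apply/sumsmx_subP => i di_neq0; rewrite genmxE.
  by rewrite -(eqmx_scale _ di_neq0) -row_diag_mx row_sub.
rewrite (mxdirectP _) /=; last by apply: mxdirect_delta => i j _ _.
rewrite (eq_bigr (fun=> 1%N)) => [|i _]; last by rewrite genmxE mxrank_delta.
by rewrite sum1dep_card.
Qed.

Section Gram.
Variable C : numClosedFieldType.
Implicit Types (n d : nat).

(** The kernel of M* is the orthogonal complement of the row space of M, and
    so meets that row space trivially. *)
Lemma mxrank_mul_adjoint n d (M : 'M[C]_(n, d)) : \rank (M *m M^t*) = \rank M.
Proof.
rewrite -[RHS](mxrank_mul_ker M (M^t*)) capmxC orthomx_disj ?mxrank0 ?addn0 //.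
by rewrite orthomx1E mulmx_ker.
Qed.

Definition repmx n d (r : 'I_n -> 'cV[C]_d) : 'M[C]_(n, d) :=
  \matrix_i (r i)^T.

Definition grammx n d (r : 'I_n -> 'cV[C]_d) : 'M[C]_n :=
  repmx r *m (repmx r)^t*.

Lemma cdotE d (v w : 'cV[C]_d) : cdot v w = \sum_k v k 0 * (w k 0)^*.
Proof.
by rewrite /cdot dotmxE mxE; apply: eq_bigr => k _; rewrite !mxE.
Qed.

Lemma grammxE n d (r : 'I_n -> 'cV[C]_d) i j :
  grammx r i j = cdot (r i) (r j).
Proof. by rewrite cdotE mxE; apply: eq_bigr => k _; rewrite !mxE. Qed.

Lemma orth_rep_gram n d (e : rel 'I_n) (r : 'I_n -> 'cV[C]_d) :
  orth_rep e r <-> has_graph e (grammx r).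
Proof.
by split=> er i j ij; have := er i j ij; rewrite grammxE.
Qed.

(** Spans are defined through a coordinate isomorphism [v2r] of the ambient
    space, here column vectors; the proof transports the rows of [repmx r]
    along it. *)
Lemma rep_rankE n d (r : 'I_n -> 'cV[C]_d) : rep_rank r = \rank (repmx r).
Proof.
rewrite /rep_rank /dimv /span locked_withE genmxE.
set X := in_tuple _.
(* B is the coordinate isomorphism, precomposed with transposition so as to
   act on rows, and B' is its inverse. *)
pose B : 'M[C]_(d, _) := lin1_mx (v2r \o (@trmx C 1 d)).
pose B' : 'M[C]_(_, d) := lin1_mx ((@trmx C d 1) \o r2v).
have vB (v : 'cV[C]_d) : v^T *m B = v2r v by rewrite mul_rV_lin1 /= trmxK.
have B_free : row_free B.
  apply/row_freeP; exists B'; apply/row_matrixP => i.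
  rewrite row_mul row1 rowE -[delta_mx 0 i]trmxK vB mul_rV_lin1 /=.
  by rewrite v2rK.
rewrite -(mxrankMfree _ B_free); apply: eqmx_rank; apply/andP; split.
  apply/row_subP => i; rewrite rowK.
  have /mapP[j _ ->] : tnth X i \in [seq r i | i : 'I_n] by apply: mem_tnth.
  by rewrite -vB submxMr // -(rowK (fun i => (r i)^T)) row_sub.
apply/row_subP => j; rewrite row_mul rowK vB.
have /tnthP[i ->] : r j \in X by apply: map_f; rewrite mem_enum.
by rewrite -(rowK (fun i => v2r (tnth X i))) row_sub.
Qed.

Lemma rank_grammx n d (r : 'I_n -> 'cV[C]_d) : \rank (grammx r) = rep_rank r.
Proof. by rewrite mxrank_mul_adjoint rep_rankE. Qed.

Lemma psd_grammx n d (r : 'I_n -> 'cV[C]_d) : psdmx (grammx r).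
Proof.
split.
  apply/is_hermitianmxP; rewrite expr0 scale1r /grammx trmx_mul map_mxM.
  by rewrite trmxCK.
(* The form x* M M* x is the squared norm of x* M. *)
move=> x; set y := x^t* *m repmx r.
have -> : x^t* *m grammx r *m x = y *m y^t*.
  by rewrite /y trmx_mul map_mxM /= trmxCK /grammx !mulmxA.
by rewrite mxE sumr_ge0 // => k _; rewrite !mxE mul_conjC_ge0.
Qed.

Lemma cdot_unitary d (U : 'M[C]_d) (v w : 'cV[C]_d) :
  U \is unitarymx -> cdot (U *m v) (U *m w) = cdot v w.
Proof.
rewrite -trmx_unitary => U_unit.
rewrite /cdot !dotmxE !trmx_mul map_mxM /= mulmxA.
by rewrite mulmxtVK.
Qed.

Lemma unitarymxX d (U : 'M[C]_d) k : U \is unitarymx -> U ^+ k \is unitarymx.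
Proof.
move=> U_unit; elim: k => [|k IHk]; last by rewrite exprS mul_unitarymx.
by apply/unitarymxP; rewrite expr0 mul1mx trmx1 map_mx1.
Qed.

(** Applying U^j' to both entries of <U^i x, U^j x>, and U^j to both entries
    of <U^i' x, U^j' x>, makes the second entries equal, and the exponents of
    the first ones congruent modulo n. *)
Lemma circulant_grammx n d (r : 'I_n -> 'cV[C]_d) :
  cyclically_symmetric r -> circulantmx (grammx r).
Proof.
move=> [U [x [U_unit Un1 rE]]] i j i' j' eq_ij; rewrite !grammxE !rE.
have Umod k l : k = l %[mod n] -> U ^+ k = U ^+ l.
  by move=> eq_kl; rewrite -(expr_mod k Un1) eq_kl expr_mod.
rewrite -(cdot_unitary _ _ (unitarymxX j' U_unit)).
rewrite -[RHS](cdot_unitary _ _ (unitarymxX j U_unit)) !mulmxA.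
have UD k l : U ^+ k *m U ^+ l = U ^+ (l + k) by rewrite addnC exprD.
by rewrite !UD (Umod _ _ eq_ij) (addnC j).
Qed.

End Gram.

(** * Fourier diagonalization of circulant matrices *)

Section Fourier.
Variables (C : numClosedFieldType) (n : nat) (z : C).
Hypothesis z_prim : n.-primitive_root z.

Let z_expn : z ^+ n = 1. Proof. exact: prim_expr_order. Qed.

Lemma prim_root_mul_conj : z * z^* = 1.
Proof.
have /eqP : `|z| ^+ n = 1 by rewrite -normrX z_expn normr1.
rewrite pexpr_eq1 ?normr_ge0 ?(prim_order_gt0 z_prim) // => /eqP z1.
by rewrite -normCK z1 expr1n.
Qed.

(** Sylvester's clock matrix; [Umx R n] is the instance at [z := omega R n]. *)
Definition clockmx : 'M[C]_n := diag_mx (\row_(j < n) z ^+ j).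

Definition dftmx : 'M[C]_n := \matrix_(i, j) z ^+ (i * j).

Lemma clockmxX k : clockmx ^+ k = diag_mx (\row_(j < n) z ^+ (k * j)).
Proof.
elim: k => [|k IHk].
  rewrite expr0; apply/matrixP => i j; rewrite !mxE.
  by rewrite mul0n expr0.
rewrite exprS IHk -[_ * _]/(clockmx *m _) mulmx_diag; congr diag_mx.
by apply/rowP => j; rewrite !mxE -exprD.
Qed.

Lemma clockmx_unitary : clockmx \is unitarymx.
Proof.
apply/unitarymxP; rewrite tr_diag_mx map_diag_mx mulmx_diag.
rewrite -diag_const_mx; congr diag_mx; apply/rowP => j; rewrite !mxE.
by rewrite rmorphXn /= -exprMn prim_root_mul_conj expr1n.
Qed.

Lemma clockmx_order : clockmx ^+ n = 1%:M.
Proof.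
rewrite clockmxX -diag_const_mx; congr diag_mx; apply/rowP => j.
by rewrite !mxE exprM z_expn expr1n.
Qed.

(** The factorization that turns support sizes into ranks, and Gram matrices
    into Fourier-diagonalized matrices. *)
Lemma repmx_clock (x : 'cV[C]_n) :
  repmx (fun i => clockmx ^+ i *m x) = dftmx *m diag_mx x^T.
Proof.
apply/matrixP => i j; rewrite [LHS]mxE [LHS]mxE clockmxX.
by rewrite mul_diag_mx mul_mx_diag !mxE.
Qed.

(** The (l, m) entry of F* A F is a double sum over row and column indices of
    A. Shifting both indices cyclically by 1 preserves A, but multiplies each
    summand by z^(m - l). The entry is therefore fixed by a factor that differs
    from 1 unless l = m. *)
Lemma dft_circulant_is_diag (A : 'M[C]_n) :
  circulantmx A -> is_diag_mx (dftmx^t* *m A *m dftmx).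
Proof.
move=> A_circ; apply/is_diag_mxP => l m neq_lm.
set D := _ *m _.
have DE : D l m =
    \sum_(i < n) \sum_(j < n) (z ^+ (i * l))^* * A i j * z ^+ (j * m).
  rewrite /D -mulmxA mxE; apply: eq_bigr => i _; rewrite !mxE mulr_sumr.
  by apply: eq_bigr => j _; rewrite !mxE mulrA.
have zS (i : 'I_n) k : z ^+ (ordS i * k) = z ^+ k * z ^+ (i * k).
  rewrite mulnC exprM exprAC prim_expr_mod // exprAC -exprM mulnC mulSn.
  by rewrite exprD.
have A_shift (i j : 'I_n) : A (ordS i) (ordS j) = A i j.
  by apply: A_circ => /=; rewrite modnDml modnDmr addSnnS.
(* As conj z is the inverse of z, this is z^(m - l). *)
pose w := (z ^+ l)^* * z ^+ m.
have D_shift : D l m = w * D l m.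
  rewrite {1}DE (reindex_inj (@ordS_inj n)) /= DE mulr_sumr.
  apply: eq_bigr => i _; rewrite (reindex_inj (@ordS_inj n)) mulr_sumr.
  apply: eq_bigr => j _; rewrite A_shift !zS rmorphM /w /=.
  by rewrite -!mulrA [z ^+ m * (_ * _)]mulrCA [A i j * _]mulrCA.
have w_neq1 : w != 1.
  apply: contra neq_lm => /eqP w1.
  have : z ^+ l = z ^+ m.
    rewrite -[LHS]mulr1 -w1 mulrA rmorphXn /= -exprMn prim_root_mul_conj.
    by rewrite expr1n mul1r.
  by move/eqP; rewrite (eq_prim_root_expr z_prim) !modn_small.
have /eqP : (1 - w) * D l m = 0 by rewrite mulrBl mul1r -D_shift subrr.
by rewrite mulf_eq0 subr_eq0 eq_sym (negbTE w_neq1) => /eqP.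
Qed.

(** Off the diagonal this is [dft_circulant_is_diag] for the identity matrix. *)
Lemma dft_ortho : dftmx^t* *m dftmx = n%:R%:M.
Proof.
have id_circ : circulantmx (1%:M : 'M[C]_n).
  move=> i j i' j' eq_ij; rewrite !mxE; congr (_ %:R); congr nat_of_bool.
  apply/eqP/eqP => eq; move/eqP: eq_ij; rewrite eq.
    by rewrite addnC eqn_modDr !modn_small // => /eqP/val_inj ->.
  by rewrite (addnC j') eqn_modDr !modn_small // => /eqP/val_inj ->.
have := dft_circulant_is_diag id_circ; rewrite mulmx1 => /is_diag_mxP F_diag.
apply/matrixP => l m; rewrite [RHS]mxE.
have [<- | neq_lm] := eqVneq l m; last by rewrite F_diag.
rewrite mulr1n mxE -[n in RHS]card_ord -sumr_const; apply: eq_bigr => i _.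
by rewrite !mxE rmorphXn /= -exprMn mulrC prim_root_mul_conj expr1n.
Qed.

Let n_neq0 : n%:R != 0 :> C.
Proof. by rewrite pnatr_eq0 -lt0n (prim_order_gt0 z_prim). Qed.

Lemma dftmx_unit : dftmx \in unitmx.
Proof.
suff : (n%:R^-1 *: dftmx^t*) *m dftmx = 1%:M by move/mulmx1_unit => [].
by rewrite -scalemxAl dft_ortho scale_scalar_mx mulVf.
Qed.

Lemma rank_dft_diag (d : 'rV[C]_n) :
  \rank (dftmx *m diag_mx d) = #|[set i | d 0 i != 0]|.
Proof.
rewrite -rank_diag_mx; apply: eqmx_rank; apply/eqmxP/eqmxMfull.
by rewrite row_full_unit dftmx_unit.
Qed.

(** The diagonal entries of F* A F are values of the quadratic form of A at the
    columns of F, hence nonnegative; the diagonal d is recovered from them by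
    inverting F* F = F F* = n I on both sides. *)
Lemma psd_circulant_dft (A : 'M[C]_n) :
  psdmx A -> circulantmx A ->
  exists2 d : 'rV[C]_n,
    (forall i, 0 <= d 0 i) & A = dftmx *m diag_mx d *m dftmx^t*.
Proof.
move=> [_ A_psd] A_circ.
exists (\row_i ((dftmx^t* *m A *m dftmx) i i / n%:R ^+ 2)).
  move=> i; rewrite mxE divr_ge0 ?exprn_ge0 ?ler0n //.
  have -> : (dftmx^t* *m A *m dftmx) i i =
      ((col i dftmx)^t* *m A *m col i dftmx) 0 0.
    rewrite tr_col map_row -row_mul !mxE.
    by apply: eq_bigr => k _; rewrite !mxE.
  exact: A_psd.
have [d dE] := diag_mxP _ (dft_circulant_is_diag A_circ).
set d' := \row_i _.
have -> : d' = (n%:R ^+ 2)^-1 *: d.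
  apply/rowP => i.
  by rewrite [LHS]mxE dE [diag_mx _ _ _]mxE eqxx mulr1n mxE mulrC.
have dft_ortho' : dftmx *m dftmx^t* = n%:R%:M.
  have : dftmx *m (n%:R^-1 *: dftmx^t*) = 1%:M.
    by apply: mulmx1C; rewrite -scalemxAl dft_ortho scale_scalar_mx mulVf.
  rewrite -scalemxAr => /(congr1 ( *:%R n%:R)).
  by rewrite scalerA mulfV // scale1r scalemx1.
rewrite linearZ /= -scalemxAr -scalemxAl -dE !mulmxA dft_ortho' -!mulmxA.
rewrite dft_ortho' mul_scalar_mx mul_mx_scalar !scalerA -mulrA -expr2.
by rewrite mulVf ?scale1r // expf_neq0.
Qed.
End Fourier.

(** * The real case and the root of unity exp(2 pi i / n) *)

Section ComplexExponential.
Variables (R : realType) (n : nat).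
Hypothesis n_gt0 : (0 < n)%N.

Let n_neq0 : n%:R != 0 :> R. Proof. by rewrite pnatr_eq0 -lt0n. Qed.

Lemma omegaX m : omega R n ^+ m =
  Complex (cos (m%:R * (2 * pi / n%:R))) (sin (m%:R * (2 * pi / n%:R))).
Proof.
elim: m => [|m IHm]; first by rewrite expr0 mul0r cos0 sin0.
rewrite exprS IHm /omega; set t := 2 * pi / n%:R; rewrite mulrS mulrDl mul1r.
rewrite cosD sinD.
by rewrite [sin t * _ + _]addrC.
Qed.

(** For 0 < m < n, half the angle of omega^m lies strictly between 0 and pi, so
    its sine is positive and cos (2 h) = 1 - 2 sin(h)^2 < 1. *)
Lemma omega_primitive : n.-primitive_root (omega R n).
Proof.
apply/andP; split=> //; apply/forallP => i; rewrite unity_rootE omegaX.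
set t := _ * _; have [im_n | im_neq] := eqVneq i.+1 n.
  have -> : t = pi *+ 2 by rewrite /t im_n mulrC divfK // mulr_natl.
  by rewrite cos2pi sin2pi eqxx.
have i_lt : (i.+1 < n)%N by rewrite ltn_neqAle im_neq ltn_ord.
pose h : R := pi * (i.+1%:R / n%:R).
have -> : t = h *+ 2.
  rewrite /t /h -[RHS]mulr_natl -!mulrA mulrCA; congr (_ * _).
  by rewrite mulrCA.
have sin_h : 0 < sin h.
  apply: sin_gt0_pi; rewrite mulr_gt0 ?pi_gt0 ?divr_gt0 ?ltr0n //=.
  by rewrite gtr_pMr ?pi_gt0 // ltr_pdivrMr ?ltr0n // mul1r ltr_nat.
apply/eqP/negbTE; rewrite eq_complex /= negb_and; apply/orP; left.
rewrite lt_eqF // cos_mulr2n cos2sin2 mulrnBl addrAC -[X in _ < X]subr0.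
by rewrite mulr2n addrK ltrD2l ltrN2 pmulrn_rgt0 // exprn_gt0.
Qed.

Definition clockrep (x : 'cV[R]_n) (i : 'I_n) : 'cV[R[i]]_n :=
  Umx R n ^+ i *m map_mx (real_complex R) x.

Lemma repmx_clockrep (x : 'cV[R]_n) :
  repmx (clockrep x) =
  dftmx n (omega R n) *m diag_mx (map_mx (real_complex R) x)^T.
Proof. exact: repmx_clock. Qed.

Lemma rep_rank_clockrep (x : 'cV[R]_n) :
  rep_rank (clockrep x) = #|[set i | x i 0 != 0]|.
Proof.
rewrite rep_rankE repmx_clockrep rank_dft_diag; last exact: omega_primitive.
by congr #|pred_of_set _|; apply/setP => i; rewrite !inE !mxE fmorph_eq0.
Qed.

Lemma cyclically_symmetric_clockrep (x : 'cV[R]_n) :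
  cyclically_symmetric (clockrep x).
Proof.
exists (Umx R n), (map_mx (real_complex R) x); split=> //.
  exact: clockmx_unitary omega_primitive.
exact: clockmx_order omega_primitive.
Qed.

(** The coordinates of x are the square roots of the Fourier diagonal of A. *)
Lemma psd_circulant_clockrep (A : 'M[R[i]]_n) :
  psdmx A -> circulantmx A ->
  exists2 x : 'cV[R]_n, (forall i, 0 <= x i 0) & A = grammx (clockrep x).
Proof.
move=> A_psd A_circ.
have [d d_ge0 ->] := psd_circulant_dft omega_primitive A_psd A_circ.
exists (\col_i Num.sqrt (complex.Re (d 0 i))).
  by move=> i; rewrite mxE sqrtr_ge0.
rewrite /grammx repmx_clockrep trmx_mul map_mxM /= tr_diag_mx map_diag_mx.
rewrite mulmxA -[_ *m diag_mx _ *m diag_mx _]mulmxA mulmx_diag.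
congr (_ *m diag_mx _ *m _); apply/rowP => i; rewrite !mxE.
have [Im_d Re_d] : complex.Im (d 0 i) = 0 /\ 0 <= complex.Re (d 0 i).
  by have := d_ge0 i; rewrite lecE /= => /andP[/eqP -> ->].
rewrite /= conj_Creal; last by apply/complex_realP; eexists.
rewrite -rmorphM -expr2 sqr_sqrtr //; apply/eqP.
by rewrite eq_complex /= Im_d !eqxx.
Qed.

End ComplexExponential.

Theorem theorem3p13 (R : realType) (n : nat) (S : {pred nat}) (k : nat) :
  (0 < n)%N ->
  {in S, forall s, (0 < s < n)%N} ->
  {in S, forall s, ((n - s) %% n)%N \in S} ->
  [<-> exists A : 'M[R[i]]_n,
         [/\ psdmx A, circulantmx A, \rank A = k
           & has_graph (circ_graph S) A];
       exists (d : nat) (r : 'I_n -> 'cV[R[i]]_d),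
         [/\ orth_rep (circ_graph S) r, cyclically_symmetric r
           & rep_rank r = k];
       exists x : 'cV[R]_n,
         [/\ forall i, 0 <= x i 0, #|[set i : 'I_n | x i 0 != 0]| = k
           & orth_rep (circ_graph S)
               (fun i : 'I_n =>
                  Umx R n ^+ i *m map_mx (real_complex R) x)]].
Proof.
move=> n_gt0 _ _.
have gram_realizes (d : nat) (r : 'I_n -> 'cV[R[i]]_d) :
    orth_rep (circ_graph S) r -> cyclically_symmetric r ->
  [/\ psdmx (grammx r), circulantmx (grammx r),
      \rank (grammx r) = rep_rank r & has_graph (circ_graph S) (grammx r)].
  move=> /orth_rep_gram rG r_sym; split=> //; first exact: psd_grammx.
    exact: circulant_grammx.
  exact: rank_grammx.
tfae.
- move=> [A [A_psd A_circ rankA AG]].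
  have [x _ AE] := psd_circulant_clockrep n_gt0 A_psd A_circ.
  exists n, (clockrep x); split; last by rewrite -rank_grammx -AE.
    by apply/orth_rep_gram; rewrite -AE.
  exact: cyclically_symmetric_clockrep.
- move=> [d [r [rG r_sym rank_r]]].
  have [A_psd A_circ rankA AG] := gram_realizes d r rG r_sym.
  have [x x_ge0 AE] := psd_circulant_clockrep n_gt0 A_psd A_circ.
  exists x; split=> //.
    by rewrite -rep_rank_clockrep // -rank_grammx -AE rankA.
  by apply/orth_rep_gram; rewrite AE in AG.
- move=> [x [_ supp_x xG]].
  have x_sym := cyclically_symmetric_clockrep n_gt0 x.
  have := gram_realizes n (clockrep x) xG x_sym.
  by rewrite rep_rank_clockrep // supp_x; exists (grammx (clockrep x)).
Qed.
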